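(* There is an absolute constant $c>0$ such that for every distributed algorithm $A$ computing a connected monotone search strategy, and for arbitrarily large $n$, there exists an $n$-node partial grid network $G$ and a homebase $h$ with \[\frac{A(G,h)}{\mathrm{mcs}(G)} \ge c\,\frac{\sqrt{n}}{\log n},\] i.e. $A(G,h)/\mathrm{mcs}(G) = \Omega(\sqrt{n}/\log n)$.
   Context: Graph searching. Let $G$ be a simple connected undirected graph. A connected $k$-search strategy starting at a node $h$ (the homebase) begins with $k$ searchers on $h$ and is a sequence of moves, each move sliding one searcher from its current node $u$ along an edge $\{u,v\}$ to $v$. Initially all edges are contaminated; an edge becomes clean when a searcher slides along it, and a clean edge becomes recontaminated whenever one of its endpoints is not occupied by a searcher and is incident to a contaminated edge. The subgraph of clean edges must be connected after every move, and after the last move all edges must be clean. The strategy is monotone if no recontamination ever occurs. $\mathrm{mcs}(G)$ denotes the minimum $k$ such that some monotone connected $k$-search strategy for $G$ exists (for some homebase). Distributed setting. The network is unknown in advance to the searchers; all searchers start at the homebase, nodes are anonymous, searchers have identifiers, edges at each node carry port labels indicating their direction (left, right, up, down), and the searchers learn the network only as they move along its edges, producing a monotone connected search strategy. For a distributed algorithm $A$, $A(G,h)$ denotes the number of searchers $A$ uses to clean $G$ starting from homebase $h$. A partial grid is a graph whose nodes are points with integer coordinates in the plane, in which two adjacent nodes are at Euclidean distance exactly one. *)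

(* Defs.v *)
From HB Require Import structures.
From mathcomp Require Import all_boot all_order all_algebra.
From mathcomp Require Import finmap.
From mathcomp Require classical_sets.
Set Implicit Arguments.
Unset Strict Implicit.
Unset Printing Implicit Defensive.

Record sgraph := SGraph {
  vertex :> finType;
  adj : rel vertex;
  adj_sym : symmetric adj;
  adj_irr : irreflexive adj }.

Definition connected_graph (G : sgraph) : Prop :=
  forall u v : G, connect (@adj G) u v.

Definition edges (G : sgraph) : {set {set G}} :=
  [set e : {set G} | [exists u, exists v, adj u v && (e == [set u; v])]].

Section Search.
Variable G : sgraph.
Implicit Types (pos : nat -> G) (occ : {set G}) (C : {set {set G}}).

(* The move (i, v) slides searcher i from its current node to v. *)
Definition move : Type := (nat * G)%type.

Definition slide pos (m : move) : nat -> G :=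
  fun j => if j == m.1 then m.2 else pos j.

Definition occupied (team : seq nat) pos : {set G} :=
  [set v | has (fun i => pos i == v) team].

Definition spreads occ : rel {set G} := fun e f =>
  [&& e \in edges G, f \in edges G & [exists v in e :&: f, v \notin occ]].

Definition contaminated occ C : {set {set G}} :=
  [set e in edges G | [exists f in edges G :\: C, connect (spreads occ) f e]].

Definition swept pos C (m : move) : {set {set G}} := [set pos m.1; m.2] |: C.

(* Clean edges once recontamination has spread as far as it can. *)
Definition clean_after (team : seq nat) pos C (m : move) : {set {set G}} :=
  edges G :\: contaminated (occupied team (slide pos m)) (swept pos C m).

Definition connected_subgraph C : bool :=
  [forall u in cover C, forall v in cover C,
     connect (fun x y => [set x; y] \in C) u v].

Fixpoint connected_search (team : seq nat) pos C (s : seq move) : bool :=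
  if s is m :: s' then
    let C' := clean_after team pos C m in
    [&& m.1 \in team, adj (pos m.1) m.2, connected_subgraph C'
      & connected_search team (slide pos m) C' s']
  else C == edges G.

Fixpoint monotone (team : seq nat) pos C (s : seq move) : bool :=
  if s is m :: s' then
    let C' := clean_after team pos C m in
    (swept pos C m \subset C') && monotone team (slide pos m) C' s'
  else true.

(* Identifiers are arbitrary natural numbers; only the size of the team
   matters. *)
Definition mc_search_strategy (k : nat) (h : G) (s : seq move) : Prop :=
  exists team : seq nat,
    [/\ uniq team, size team = k, (0 < k)%N,
        connected_search team (fun=> h) set0 s
      & monotone team (fun=> h) set0 s].

End Search.

(* Equal to 0 when no natural number satisfies P. *)
Definition least (P : nat -> Prop) : nat :=
  classical_sets.xget 0%N (fun k => P k /\ forall j, P j -> (k <= j)%N).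

Definition mcs (G : sgraph) : nat :=
  least (fun k => exists (h : G) (s : seq (move G)), mc_search_strategy k h s).

Section PartialGrid.
Import GRing.Theory.
Local Open Scope ring_scope.

Definition sqdist (p q : int * int) : int :=
  (p.1 - q.1) ^+ 2 + (p.2 - q.2) ^+ 2.

Record partial_grid := PartialGrid {
  pg_nodes : {fset int * int};
  pg_adj : rel pg_nodes;
  pg_sym : symmetric pg_adj;
  pg_dist : forall u v, pg_adj u v -> sqdist (val u) (val v) = 1 }.

Lemma pg_irr (G : partial_grid) : irreflexive (@pg_adj G).
Proof.
by move=> u; apply/negP => /pg_dist; rewrite /sqdist !subrr.
Qed.

Definition grid_graph (G : partial_grid) : sgraph :=
  SGraph (@pg_sym G) (@pg_irr G).

Inductive direction := Left | Right | Up | Down.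

Definition dir_code (d : direction) : bool * bool :=
  match d with
  | Left => (false, false) | Right => (false, true)
  | Up => (true, false) | Down => (true, true)
  end.
Definition dir_decode (b : bool * bool) : direction :=
  if b.1 then (if b.2 then Down else Up) else (if b.2 then Right else Left).
Lemma dir_codeK : cancel dir_code dir_decode. Proof. by case. Qed.

Definition step (d : direction) (p : int * int) : int * int :=
  match d with
  | Left => (p.1 - 1, p.2) | Right => (p.1 + 1, p.2)
  | Up => (p.1, p.2 + 1) | Down => (p.1, p.2 - 1)
  end.

End PartialGrid.

Coercion grid_graph : partial_grid >-> sgraph.
HB.instance Definition _ := Equality.copy direction (can_type dir_codeK).
HB.instance Definition _ := Choice.copy direction (can_type dir_codeK).
HB.instance Definition _ := Countable.copy direction (can_type dir_codeK).
HB.instance Definition _ := Finite.copy direction (can_type dir_codeK).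

Definition leads (G : partial_grid) (d : direction) (u v : G) : bool :=
  adj u v && (val v == step d (val u)).

Definition ports (G : partial_grid) (u : G) : {set direction} :=
  [set d | [exists v, leads d u v]].

(* All that has been learned: for each past move, in chronological order, the
   searcher, the port it left by, and the ports it found on arrival.  Neither
   nodes nor coordinates appear: nodes are anonymous. *)
Definition history : Type := seq (nat * direction * {set direction}).

(* The ports of the homebase and the history determine the next move, [None]
   meaning termination.  A deterministic protocol in which the searchers have
   only partial knowledge, under whatever communication rules, induces such a
   function; conversely full information sharing realises all of them.  The
   supply of searchers at the homebase is unbounded. *)
Definition algorithm : Type :=
  {set direction} -> history -> option (nat * direction).

Fixpoint runs_from (A : algorithm) (G : partial_grid) (h : G)
    (pos : nat -> G) (l : history) (s : seq (move G)) : bool :=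
  match s, A (ports h) l with
  | [::], None => true
  | m :: s', Some (i, d) =>
      [&& m.1 == i, leads d (pos i) m.2
        & runs_from A h (slide pos m) (rcons l (i, d, ports m.2)) s']
  | _, _ => false
  end.

(* [s] is the complete (terminating) execution of A on G from h; there is at
   most one such [s]. *)
Definition execution (A : algorithm) (G : partial_grid) (h : G)
    (s : seq (move G)) : Prop :=
  runs_from A h (fun=> h) [::] s.

Definition computes_mc_search (A : algorithm) : Prop :=
  forall (G : partial_grid) (h : G), connected_graph G ->
    exists s k, execution A h s /\ mc_search_strategy k h s.

(* The least number of searchers on the homebase with which the execution of A
   is a monotone connected search strategy. *)
Definition searchers_used (A : algorithm) (G : partial_grid) (h : G) : nat :=
  least (fun k => exists s, execution A h s /\ mc_search_strategy k h s).
Arguments searchers_used : clear implicits.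

(* Main.v *)
Require Import Defs.
From mathcomp Require Import all_boot all_order all_algebra.
From mathcomp Require Import finmap boolp reals exp.
From mathcomp Require Import zify lra.
From mathcomp Require classical_sets.
Set Implicit Arguments.
Unset Strict Implicit.
Unset Printing Implicit Defensive.
Import Order.TTheory GRing.Theory Num.Theory.

(** The networks are binary trees drawn on the triangle x, y >= 0, x + y <= L,
    rooted at the origin, each of whose edges joins two consecutive diagonals.
    Exactly one vertex of each diagonal d < L branches, going both up and right;
    the vertices to its left only go up and those to its right only go right.
    Answering adaptively, an adversary lets the first vertex reached on each
    diagonal be the branching one.  When diagonal L is first reached, every
    branching vertex has been visited but only one leaf has, so about L
    unvisited subtrees hang from visited vertices; all those vertices must be
    guarded, which takes at least L/2 searchers, and L is of order sqrt n.

    On the other hand, starting at the root of any n-vertex tree and always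
    cleaning the smallest pending subtree first takes O(log n) searchers. *)

(** * Searching trees *)

Lemma card_occupied (G : sgraph) (team : seq nat) (pos : nat -> G) :
  #|occupied team pos| <= size team.
Proof.
rewrite -(size_map pos team); apply: leq_trans (card_size _).
apply/subset_leq_card/subsetP => v; rewrite inE => /hasP[i it /eqP <-].
exact: map_f.
Qed.

Lemma edge_in (G : sgraph) (u v : G) : ([set u; v] \in edges G) = adj u v.
Proof.
rewrite inE; apply/existsP/idP => [[x /existsP[y /andP[xy /eqP e]]]|uv]; last first.
  by exists u; apply/existsP; exists v; rewrite uv eqxx.
have: x \in [set u; v] by rewrite e set21.
have: y \in [set u; v] by rewrite e set22.
have: u \in [set x; y] by rewrite -e set21.
have: v \in [set x; y] by rewrite -e set22.
rewrite !inE => + + /orP[]/eqP ? /orP[]/eqP ?; subst.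
- by rewrite adj_irr in xy.
- by rewrite adj_sym.
- by [].
- by rewrite adj_irr in xy.
Qed.

Lemma edgesP (G : sgraph) (e : {set G}) :
  reflect (exists u v, adj u v /\ e = [set u; v]) (e \in edges G).
Proof.
rewrite inE; apply: (iffP existsP) => [[u /existsP[v /andP[uv /eqP ->]]]|[u [v [uv ->]]]].
  by exists u, v.
by exists u; apply/existsP; exists v; rewrite uv eqxx.
Qed.

(** * Guards against recontamination *)

Section Guarding.
Variable G : sgraph.
Implicit Types (pos : nat -> G) (occ : {set G}) (C : {set {set G}}).

Definition boundary C : {set G} :=
  [set v | [exists e in C, v \in e] && [exists f in edges G :\: C, v \in f]].

Lemma clean_after_sub team pos C (m : move G) :
  clean_after team pos C m \subset swept pos C m.
Proof.
apply/subsetP => e; rewrite inE => /andP[+ eE]; apply: contraR => eS.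
by rewrite inE eE; apply/existsP; exists e; rewrite inE eS eE connect0.
Qed.

(** Read a chain of recontamination backwards from a swept edge. Consecutive edges share an
    unoccupied vertex; were the later edge swept and the earlier one not, that vertex would lie in
    the boundary. So the whole chain is swept and cannot start at a contaminated edge. *)
Lemma clean_after_guarded team pos C (m : move G) :
  swept pos C m \subset edges G ->
  boundary (swept pos C m) \subset occupied team (slide pos m) ->
  clean_after team pos C m = swept pos C m.
Proof.
move=> SE guard; apply/eqP; rewrite eqEsubset clean_after_sub /=.
apply/subsetP => e eS; rewrite inE (subsetP SE) // andbT inE negb_and.
apply/orP; right; apply/existsPn => f; rewrite negb_and orbC -implybE.
apply/implyP => /connectP[p]; elim: p f => [|g p IHp] f /=.
  by move=> _ <-; rewrite inE eS.
case/andP=> /and3P[fE gE /existsP[v]]; rewrite inE => /andP[/andP[vf vg] vocc].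
move=> gp laste; move: (IHp g gp laste); rewrite !in_setD fE gE !andbT negbK => gS.
apply/negP => fS; case/negP: vocc; apply: (subsetP guard); rewrite inE.
apply/andP; split; apply/existsP; first by exists g; rewrite gS.
by exists f; rewrite in_setD fE andbT fS.
Qed.

(** Through an unoccupied boundary vertex, a single step of recontamination already loses a swept
    edge. *)
Lemma monotone_guarded team pos C (m : move G) :
  swept pos C m \subset clean_after team pos C m ->
  boundary (swept pos C m) \subset occupied team (slide pos m).
Proof.
move=> mono; apply/subsetP => v; rewrite inE.
case/andP=> /existsP[e /andP[eS ve]] /existsP[f /andP[fD vf]].
apply: contraT => vocc; have := subsetP mono e eS.
rewrite inE inE => /andP[+ eE]; rewrite eE /= => /existsPn/(_ f).
rewrite fD /= => /negP[]; apply: connect1; rewrite /spreads eE.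
move: fD; rewrite inE => /andP[_ ->] /=; apply/existsP; exists v.
by rewrite inE vf ve.
Qed.

Definition linked C : rel G := fun x y => [set x; y] \in C.

Lemma linked_sym C : connect_sym (linked C).
Proof. by apply: sym_connect_sym => x y; rewrite /linked setUC. Qed.

Lemma mem_cover (C : {set {set G}}) e v : e \in C -> v \in e -> v \in cover C.
Proof. by move=> eC ve; apply/bigcupP; exists e. Qed.

Variables (team : seq nat) (h : G).
Hypothesis team_uniq : uniq team.

(** [h] is added because before the first move the homebase lies on no clean edge. *)
Definition territory C : {set G} := h |: cover C.

Definition cleanable pos C : Prop :=
  exists s, connected_search team pos C s /\ monotone team pos C s.

Definition rooted C : Prop :=
  C \subset edges G /\ {in territory C, forall u, connect (linked C) h u}.

(** This can differ from [boundary] only at [h], which counts here even when no clean edge touches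
    it, so that the invariant also fits the initial state. *)
Definition frontier C : {set G} :=
  [set v in territory C | [exists f in edges G :\: C, v \in f]].

Lemma boundary_sub_frontier C : boundary C \subset frontier C.
Proof.
apply/subsetP => v; rewrite !inE => /andP[/existsP[e /andP[eC ve]] ->].
by rewrite (mem_cover eC ve) orbT.
Qed.

(** The second clause keeps idle searchers inside the connected clean part, where they can walk to
    wherever they are needed. *)
Definition guarded pos C : Prop :=
  frontier C \subset occupied team pos /\
  {in team, forall i, pos i \in territory C}.

Lemma rooted_connected C : rooted C -> connected_subgraph C.
Proof.
case=> _ con; apply/forall_inP => u uC; apply/forall_inP => v vC.
apply: (@connect_trans _ _ h); last by apply: con; rewrite inE vC orbT.
by rewrite linked_sym; apply: con; rewrite inE uC orbT.
Qed.

Lemma rooted_setU1 C u v : rooted C -> adj u v -> u \in territory C ->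
  rooted ([set u; v] |: C).
Proof.
move=> [CE con] uv ut; split.
  by apply/subsetP => e; rewrite in_setU1 => /predU1P[->|/(subsetP CE)//]; rewrite edge_in.
have sub : subrel (connect (linked C)) (connect (linked ([set u; v] |: C))).
  by apply: connect_sub => x y xy; apply: connect1; rewrite /linked in_setU1 [_ \in C]xy orbT.
move=> w; rewrite in_setU1 => /predU1P[->//|/bigcupP[e]].
rewrite in_setU1 => /predU1P[->|eC we]; last first.
  by apply: sub; apply: con; rewrite in_setU1 (mem_cover eC we) orbT.
have hu := sub _ _ (con u ut).
rewrite in_set2 => /orP[]/eqP -> //; apply: connect_trans hu _; apply: connect1.
by rewrite /linked in_setU1 eqxx.
Qed.

Lemma cleanable_move pos C (m : move G) : m.1 \in team -> adj (pos m.1) m.2 ->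
  rooted (swept pos C m) ->
  boundary (swept pos C m) \subset occupied team (slide pos m) ->
  cleanable (slide pos m) (swept pos C m) -> cleanable pos C.
Proof.
move=> mt mE rS bS [s [cs ms]]; exists (m :: s) => /=.
have -> : clean_after team pos C m = swept pos C m.
  by apply: clean_after_guarded bS; case: rS.
by rewrite mt mE rooted_connected // cs ms subxx.
Qed.

Definition free pos C i : Prop :=
  {in frontier C, forall v, exists2 j, j \in team & j != i /\ pos j = v}.

Lemma exists_free pos C : frontier C \subset occupied team pos ->
  #|frontier C| < size team -> exists2 i, i \in team & free pos C i.
Proof.
move=> bocc small.
(* One guard is chosen per frontier vertex; the default 0 is never reached there, since the vertex
   is occupied. There are fewer guards than searchers, so some searcher is left over. *)
pose guard v := nth 0 team (find (fun i => pos i == v) team).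
have guardP v : v \in frontier C -> guard v \in team /\ pos (guard v) = v.
  move=> /(subsetP bocc); rewrite inE => hv.
  by split; [apply: mem_nth; rewrite -has_find | apply/eqP/(nth_find 0 hv)].
have : ~~ all [in map guard (enum (frontier C))] team.
  apply/negP => /allP /(uniq_leq_size team_uniq).
  by rewrite size_map -cardE leqNgt small.
case/allPn => i it ni; exists i => // v vb; have [gt gv] := guardP v vb.
exists (guard v) => //; split=> //; apply: contraNneq ni => <-.
by rewrite map_f // mem_enum.
Qed.

(** Sliding along clean edges leaves [C] as it is, and the other searchers hold the frontier
    meanwhile. The final positions are described pointwise, which avoids equality of functions. *)
Lemma cleanable_walk pos C i p : rooted C -> i \in team -> free pos C i ->
  path (linked C) (pos i) p ->
  (forall pos', pos' i = last (pos i) p -> (forall j, j != i -> pos' j = pos j) ->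
    cleanable pos' C) ->
  cleanable pos C.
Proof.
move=> rC it; elim: p pos => [|v p IHp] pos fr /=; first by move=> _ /(_ pos); apply.
case/andP=> iv vp cont.
have sw : swept pos C (i, v) = C by apply/setUidPr; rewrite sub1set.
have off j : j != i -> slide pos (i, v) j = pos j by rewrite /slide => /negPf ->.
have on : slide pos (i, v) i = v by rewrite /slide /= eqxx.
apply: (@cleanable_move _ _ (i, v)) => //=; rewrite ?sw //.
- by rewrite -edge_in; case: rC => /subsetP CE _; apply: CE.
- apply/subsetP => w /(subsetP (boundary_sub_frontier _))/fr[j jt [ji jw]]; rewrite inE; apply/hasP; exists j => //.
  by rewrite off // jw.
- apply: IHp; rewrite ?on //.
    by move=> w /fr[j jt [ji jw]]; exists j; rewrite ?off.
  move=> pos' e1 e2; apply: cont => // j ji; rewrite e2 // off //.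
Qed.

(** A free searcher walks through clean edges to [u] and then slides to [v]. The only possible new
    frontier vertex is [v], where it now stands. *)
Lemma cleanable_setU1 pos C u v : rooted C -> guarded pos C ->
  #|frontier C| < size team -> adj u v -> u \in territory C ->
  (forall pos', guarded pos' ([set u; v] |: C) ->
    cleanable pos' ([set u; v] |: C)) ->
  cleanable pos C.
Proof.
move=> rC [fr pt] small uv ut cont; have [CE con] := rC.
have [i it fi] := exists_free fr small.
have /connectP[p ip up] : connect (linked C) (pos i) u.
  by apply: connect_trans (con u ut); rewrite linked_sym; apply/con/pt.
apply: (cleanable_walk rC it fi ip) => pos1; rewrite -up => iu off.
have rD := rooted_setU1 rC uv ut.
have swE : swept pos1 C (i, v) = [set u; v] |: C by rewrite /swept iu.
have tE x : x \in territory ([set u; v] |: C) = (x == v) || (x \in territory C).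
  rewrite !in_setU1; apply/idP/idP => [/predU1P[->|/bigcupP[e]]|].
  - by rewrite eqxx orbT.
  - rewrite in_setU1 => /predU1P[->|eC xe]; last by rewrite (mem_cover eC xe) !orbT.
    by rewrite in_set2 orbC => /predU1P[->|/eqP->]; rewrite ?eqxx // -in_setU1 ut orbT.
  - case/predU1P=> [->|]; last case/orP=> [->//|/bigcupP[e eC xe]].
      by rewrite (@mem_cover _ [set u; v]) ?orbT ?set22 ?setU11.
    by rewrite (@mem_cover _ e) ?orbT // in_setU1 eC orbT.
have gD : guarded (slide pos1 (i, v)) ([set u; v] |: C).
  split=> [|j jt].
    apply/subsetP => w; rewrite inE tE => /andP[/orP[/eqP->|wt] /existsP[f /andP[fD wf]]].
      by rewrite inE; apply/hasP; exists i; rewrite // /slide /= eqxx.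
    have /fi[j jt [ji jw]] : w \in frontier C.
      rewrite inE wt; apply/existsP; exists f; rewrite wf andbT.
      by move: fD; rewrite !inE negb_or => /andP[/andP[_ ->]].
    by rewrite inE; apply/hasP; exists j; rewrite // /slide /= (negPf ji) off // jw.
  rewrite tE /slide /=; case: ifP => [_|/negbT ji]; first by rewrite eqxx.
  by rewrite off // pt ?orbT.
apply: (@cleanable_move _ _ (i, v)); rewrite ?swE //=; first by rewrite iu.
  by apply: subset_trans gD.1; apply: boundary_sub_frontier.
exact: cont.
Qed.

End Guarding.

(** * Rooted trees given by a parent function *)

Section Tree.
Variables (G : sgraph) (r : G) (par : G -> G) (lev : G -> nat).
Hypothesis par_root : par r = r.
Hypothesis lev_par : forall v, v != r -> lev (par v) < lev v.
Hypothesis adj_par : forall u v : G,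
  adj u v = (u != v) && ((par u == v) || (par v == u)).

Lemma par_neq v : v != r -> par v != v.
Proof. by move=> /lev_par; apply: contraTneq => ->; rewrite ltnn. Qed.

Lemma adj_parent v : v != r -> adj (par v) v.
Proof. by move=> vr; rewrite adj_par par_neq // eqxx orbT. Qed.

Lemma adj_parentP u v : adj u v -> (u != r /\ par u = v) \/ (v != r /\ par v = u).
Proof.
rewrite adj_par => /andP[uv /orP[]/eqP e]; [left | right]; split=> //.
  by apply: contraNneq uv => ur; rewrite -e ur par_root.
by apply: contraNneq uv => vr; rewrite -e vr par_root.
Qed.

Definition parent_edges (S : {set G}) : {set {set G}} :=
  [set [set par w; w] | w in S :\ r].

Lemma mem_parent_edges (S : {set G}) w : w != r -> w \in S -> [set par w; w] \in parent_edges S.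
Proof. by move=> wr wS; apply/imsetP; exists w; rewrite // !inE wr. Qed.

Lemma tree_edgeP e : reflect (exists2 w, w != r & e = [set par w; w]) (e \in edges G).
Proof.
apply: (iffP (edgesP _)) => [[u [v [/adj_parentP[[nr <-]|[nr <-]] ->]]]|[w wr ->]].
- by exists u; rewrite // setUC.
- by exists v.
- by exists (par w), w; rewrite adj_parent.
Qed.

Lemma parent_edges_setT : parent_edges setT = edges G.
Proof.
apply/setP => e; apply/imsetP/tree_edgeP => [[w]|[w wr ->]].
  by rewrite !inE andbT => wr ->; exists w.
by exists w; rewrite // !inE wr.
Qed.

Lemma parent_edgesS (S S' : {set G}) :
  S \subset S' -> parent_edges S \subset parent_edges S'.
Proof. by move=> SS'; apply/imsetS/setSD. Qed.

Lemma parent_edges_setU1 S w : w != r ->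
  parent_edges (w |: S) = [set par w; w] |: parent_edges S.
Proof.
move=> wr; rewrite /parent_edges setDUl imsetU; congr (_ :|: _).
suff -> : [set w] :\ r = [set w] by rewrite imset_set1.
by apply/setP => x; rewrite !inE; case: eqP => [->|//]; rewrite eq_sym (negPf wr).
Qed.

Definition par_closed (S : {set G}) : Prop :=
  r \in S /\ {in S, forall v, par v \in S}.

Definition unfinished (S : {set G}) : {set G} :=
  [set u in S | [exists w, (w \notin S) && (par w == u)]].

Lemma territory_parent_edges S : par_closed S -> territory r (parent_edges S) = S.
Proof.
move=> [rS clS]; apply/setP => v; rewrite in_setU1.
apply/predU1P/idP => [[->//|/bigcupP[e /imsetP[w]]]|vS].
  by rewrite in_setD1 => /andP[_ wS] -> /set2P[] ->; rewrite ?clS.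
case: (eqVneq v r) => [|vr]; [by left | right].
by apply: (mem_cover (mem_parent_edges vr vS)); rewrite set22.
Qed.

Lemma root_linked S : par_closed S ->
  {in S, forall v, connect (linked (parent_edges S)) r v}.
Proof.
move=> [rS clS] v; have [n] := ubnP (lev v); elim: n v => // n IHn v lv vS.
case: (eqVneq v r) => [->//|vr].
apply: (@connect_trans _ _ (par v)).
  by apply: IHn; rewrite ?clS // (leq_trans (lev_par vr)).
by apply: connect1; apply: mem_parent_edges.
Qed.

Lemma rooted_parent_edges S : par_closed S -> rooted r (parent_edges S).
Proof.
move=> clS; split; first by rewrite -parent_edges_setT parent_edgesS ?subsetT.
by rewrite territory_parent_edges //; apply: root_linked.
Qed.

Lemma tree_connected : connected_graph G.
Proof.
have sub : subrel (linked (edges G)) (connect (@adj G)).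
  by move=> x y; rewrite /linked edge_in; apply: connect1.
have rv v : connect (@adj G) r v.
  apply: (connect_sub sub); rewrite -parent_edges_setT.
  by apply: root_linked => //; split.
move=> u v; apply: connect_trans (rv v).
by rewrite (sym_connect_sym (@adj_sym G)).
Qed.

Lemma frontier_parent_edges S : par_closed S ->
  frontier r (parent_edges S) \subset unfinished S.
Proof.
move=> clS; apply/subsetP => v; rewrite [_ \in frontier _ _]inE [_ \in unfinished _]inE => /andP[].
rewrite territory_parent_edges // => vS /existsP[f /andP[]].
rewrite vS in_setD => /andP[fS /tree_edgeP[w wr fw]].
have wS : w \notin S by apply: contra fS => wS; rewrite fw mem_parent_edges.
rewrite fw in_set2 => /orP[]/eqP vw; last by rewrite -vw vS in wS.
by apply/existsP; exists w; rewrite wS vw eqxx.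
Qed.

Variable k : nat.

(** All guarded positions are allowed, so that finishing a larger subtree can serve as a
    continuation wherever the searchers end up. *)
Definition finishable (S : {set G}) : Prop := forall pos,
  guarded (iota 0 k) r pos (parent_edges S) ->
  cleanable (iota 0 k) pos (parent_edges S).

Lemma finishable_setT : finishable setT.
Proof. by move=> pos _; exists [::]; rewrite /= parent_edges_setT. Qed.

Lemma par_closed_setU1 S w : par_closed S -> par w \in S -> par_closed (w |: S).
Proof.
move=> [rS clS] pw; split=> [|v]; rewrite !in_setU1 ?rS ?orbT // => /predU1P[->|/clS->].
  by rewrite pw orbT.
by rewrite orbT.
Qed.

Lemma finishable_setU1 S w : par_closed S -> w \notin S -> par w \in S ->
  #|unfinished S| < k -> finishable (w |: S) -> finishable S.
Proof.
move=> clS wS pw small fin pos gp.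
have wr : w != r by apply: contraNneq wS => ->; case: clS.
apply: (cleanable_setU1 (iota_uniq _ _) (rooted_parent_edges clS) gp _ (adj_parent wr)).
- rewrite size_iota; apply: leq_ltn_trans small.
  exact/subset_leq_card/frontier_parent_edges.
- by rewrite territory_parent_edges.
- by rewrite -parent_edges_setU1.
Qed.

Definition below v : {set G} := [set w | fconnect par w v].

Lemma belowP v w : reflect (exists n, iter n par w = v) (w \in below v).
Proof.
rewrite inE; apply: (iffP idP) => [wv|[n <-]]; last exact: fconnect_iter.
by exists (findex par w v); apply: iter_findex.
Qed.

Lemma below_id v : v \in below v. Proof. by rewrite inE. Qed.

Lemma below_par v w : par w \in below v -> w \in below v.
Proof. by move=> /belowP[n e]; apply/belowP; exists n.+1; rewrite iterSr. Qed.

Lemma par_below v w : w \in below v -> w != v -> par w \in below v.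
Proof.
move=> /belowP[[|n]] /= e nwv; first by rewrite e eqxx in nwv.
by apply/belowP; exists n; rewrite -iterSr.
Qed.

Lemma lev_below v w : w \in below v -> lev v <= lev w.
Proof.
have lp x : lev (par x) <= lev x.
  by case: (eqVneq x r) => [->|/lev_par/ltnW //]; rewrite par_root.
move=> /belowP[n]; elim: n w => [|n IHn] w; first by move=> /= ->.
by rewrite iterSr => /IHn /leq_trans; apply.
Qed.

Lemma below_chain u v w : w \in below u -> w \in below v ->
  u \in below v \/ v \in below u.
Proof.
move=> /belowP[m <-] /belowP[n <-]; case/orP: (leq_total m n) => mn.
  by left; apply/belowP; exists (n - m); rewrite -iterD subnK.
by right; apply/belowP; exists (m - n); rewrite -iterD subnK.
Qed.

(** A common descendant would put one sibling below the other, hence the common parent below one of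
    its own children, against the levels. *)
Lemma siblings_disjoint u v : u != v -> u != r -> v != r -> par u = par v ->
  [disjoint below u & below v].
Proof.
have gen a b : a != b -> b != r -> par a = par b -> a \notin below b.
  move=> ab br e; apply/negP => /par_below/(_ ab)/lev_below.
  by rewrite e leqNgt lev_par.
move=> uv ur vr e; apply/pred0P => w /=; apply/negbTE/negP => /andP[wu wv].
by case: (below_chain wu wv); apply/negP; apply: gen; rewrite // eq_sym.
Qed.

(* A vertex above a child of which some subtree is still to be cleaned keeps a
   guard; cleaning the smallest pending subtree first at least halves the
   number of vertices left whenever such a guard is added. *)
Lemma finishable_below n v S : par_closed S -> v \in S ->
  {in below v :\: S, forall w, par w \in S -> par w = v} ->
  #|below v :\: S| <= n ->
  #|unfinished S :\ v| + (trunc_log 2 #|below v :\: S|.+1).+2 <= k ->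
  finishable (S :|: below v) -> finishable S.
Proof.
elim: n v S => [|n IHn] v S clS vS top small bound fin.
  move: small; rewrite leqn0 cards_eq0 setD_eq0 => /setUidPl e.
  by rewrite e in fin.
have [/setUidPl e|] := boolP (below v \subset S); first by rewrite e in fin.
have unfin_le : #|unfinished S| <= #|unfinished S :\ v|.+1.
  by rewrite [leqLHS](cardsD1 v); case: (_ \in _).
case/subsetPn => w0 w0v w0S.
(* Climb from [w] until the parent is in [S]; by [top] that parent is [v]. *)
have pending_child w : w \in below v :\: S ->
    exists c, [/\ c \notin S, par c = v & w \in below c].
  have [m] := ubnP (lev w); elim: m w => // m IHm w lw; rewrite inE => /andP[wS wv].
  have wr : w != r by apply: contraNneq wS => ->; case: clS.
  have wnv : w != v by apply: contraNneq wS => ->.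
  have [pS|pS] := boolP (par w \in S).
    by exists w; rewrite below_id top // inE wS.
  have [||c [cS cv pc]] := IHm (par w).
  - exact: leq_trans (lev_par wr) _.
  - by rewrite inE pS par_below.
  by exists c; split=> //; apply: below_par.
have [c0 [c0S c0v _]] : exists c, [/\ c \notin S, par c = v & w0 \in below c].
  by apply: pending_child; rewrite inE w0S.
have Pc0 : (c0 \notin S) && (par c0 == v) by rewrite c0S c0v /=.
(* [c] is the pending child of [v] with the smallest subtree. *)
case: (@arg_minnP _ c0 (fun c => (c \notin S) && (par c == v))
  (fun c => #|below c|) Pc0) => c /andP[cS /eqP cv] cmin.
have notS x : x \in below c -> x \notin S.
  move=> /belowP[m]; elim: m x => [|m IHm] x; first by move=> /= ->.
  by rewrite iterSr => /IHm; apply: contra; case: clS => _; apply.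
have cr : c != r by apply: contraNneq cS => ->; case: clS.
have below_cv : below c \subset below v.
  by apply/subsetP => x /belowP[m e]; apply/belowP; exists m.+1; rewrite /= e.
have sub_c : below c \subset below v :\: S.
  by apply/subsetP => x xc; rewrite inE notS // (subsetP below_cv).
have card_c : #|below c :\: (c |: S)|.+1 = #|below c|.
  rewrite (cardsD1 c (below c)) below_id add1n; congr _.+1; apply: eq_card => x.
  rewrite in_setD in_setU1 negb_or in_setD1; case: eqP => //= _.
  by case xc: (x \in below c); rewrite ?andbF ?notS.
have pcS : par c \in S by rewrite cv.
have clS1 := par_closed_setU1 clS pcS.
have unfin1 : unfinished (c |: S) :\ c \subset unfinished S.
  apply/subsetP => u; rewrite !inE => /and3P[uc]; rewrite (negPf uc) /= => -> /=.
  case/existsP=> w /andP[]; rewrite inE negb_or => /andP[_ wS] pw.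
  by apply/existsP; exists w; rewrite wS.
apply: (finishable_setU1 clS cS pcS).
  by apply: leq_ltn_trans unfin_le _; apply: leq_trans bound; rewrite !addnS !ltnS leq_addr.
have S2E : (c |: S) :|: below c = S :|: below c.
  apply/setP => x; rewrite !in_setU in_set1; case: eqP => //= ->.
  by rewrite below_id orbT.
have clS2 : par_closed (S :|: below c).
  split=> [|x]; first by rewrite inE clS.1.
  rewrite !in_setU => /orP[/clS.2->//|xc]; case: (eqVneq x c) => [->|xnc].
    by rewrite cv vS.
  by rewrite par_below ?orbT.
have disj_R : (below v :\: (S :|: below c)) = (below v :\: S) :\: below c.
  by rewrite setDDl.
have card_R : #|below v :\: (S :|: below c)| + #|below c| = #|below v :\: S|.
  by rewrite disj_R addnC -(cardsID (below c) (below v :\: S)) (setIidPr sub_c).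
have c_gt0 : 0 < #|below c| by apply/card_gt0P; exists c; apply: below_id.
(* Once the subtree of [c] is clean, the search resumes at [v] with strictly fewer vertices pending
   and no new unfinished vertex. *)
have fin2 : finishable (S :|: below c).
  apply: (IHn v) => //; rewrite ?inE ?vS //.
  - move=> w; rewrite !in_setD !in_setU negb_or => /andP[/andP[wS wc] wv].
    case/orP=> [pS|/below_par wc']; last by rewrite wc' in wc.
    by apply: top; rewrite // inE wS.
  - by rewrite -ltnS; apply: leq_trans small; rewrite -card_R -addn1 leq_add2l.
  - apply: leq_trans bound; apply: leq_add.
      apply/subset_leq_card/setSD/subsetP => u.
      rewrite !inE => /andP[uS /existsP[w]].
      rewrite !inE negb_or => /andP[/andP[wS wc] /eqP pw].
      case/orP: uS => [->|uc] /=; first by apply/existsP; exists w; rewrite wS pw /=.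
      case/negP: wc; have := @below_par c w; rewrite !inE; apply; by rewrite pw.
    by rewrite !ltnS; apply: leq_trunc_log; rewrite ltnS -card_R leq_addr.
  - by rewrite -setUA (setUidPr below_cv).
(* The subtree of [c] is cleaned by induction, with [fin2] as continuation. *)
apply: (IHn c) => //; rewrite ?setU11 ?S2E //.
- move=> w; rewrite in_setD in_setU1 negb_or => /andP[/andP[wc wS] wbc].
  have := notS _ (par_below wbc wc); rewrite in_setU1 => /negPf ->.
  by rewrite orbF => /eqP.
- by rewrite -ltnS card_c; apply: leq_trans small; rewrite subset_leq_card.
(* If [c] was the last pending child, [v] is no longer unfinished and needs no guard. Otherwise
   another pending child has a subtree at least as large, and the logarithm drops by one, which pays
   for the guard on [v]. *)
rewrite card_c; have [e|[w wR]] := set_0Vmem (below v :\: (S :|: below c)).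
  apply: leq_trans bound; apply: leq_add.
    apply: subset_leq_card; rewrite subsetD1 unfin1 /= !inE.
    apply/negP => /and3P[vc _ /existsP[w]].
    rewrite !inE negb_or => /andP[/andP[wc wS] /eqP pw].
    have wv : w \in below v by apply: below_par; rewrite pw below_id.
    have : w \in below c.
      apply: contraT => wbc; have : w \in below v :\: (S :|: below c).
        by rewrite in_setD in_setU negb_or wS wbc wv.
      by rewrite e inE.
    by move=> /par_below/(_ wc)/notS; rewrite pw vS.
  by rewrite !ltnS; apply: leq_trunc_log; rewrite leqW // subset_leq_card.
have two : 2 * #|below c| <= #|below v :\: S|.
  rewrite -card_R mul2n -addnn leq_add2r.
  move: (wR); rewrite in_setD in_setU negb_or => /andP[/andP[wS wc] wv].
  have [c' [c'S c'v wc']] : exists c, [/\ c \notin S, par c = v & w \in below c].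
    by apply: pending_child; rewrite inE wS.
  apply: (leq_trans (cmin c' _)); first by rewrite c'S c'v /=.
  have c'r : c' != r by apply: contraNneq c'S => ->; case: clS.
  have cc' : c' != c by apply: contraNneq wc => <-.
  apply/subset_leq_card/subsetP => x xc'; rewrite disj_R !in_setD.
  have /pred0P/(_ x)/= := siblings_disjoint cc' c'r cr (etrans c'v (esym cv)).
  rewrite xc' /= => -> /=.
  have -> : x \in below v.
    by move: xc' => /belowP[m e]; apply/belowP; exists m.+1; rewrite /= e.
  rewrite andbT; move: xc' => /belowP[m]; elim: m x => [|m IHm] x; first by move=> /= ->.
  by rewrite iterSr => /IHm; apply: contra; case: clS => _; apply.
apply: leq_trans bound.
have log_two : (trunc_log 2 #|below c|).+1 <= trunc_log 2 #|below v :\: S|.+1.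
  by rewrite -trunc_log2_double //; apply: leq_trunc_log; rewrite leqW // -mul2n.
apply: (@leq_trans (#|unfinished S :\ v|.+1 + (trunc_log 2 #|below c|).+2)).
  by rewrite leq_add2r; apply: leq_trans unfin_le; rewrite subset_leq_card.
by rewrite addSnnS leq_add2l !ltnS.
Qed.

Lemma below_root : below r = setT.
Proof.
apply/setP => v; rewrite in_setT; have [n] := ubnP (lev v); elim: n v => // n IHn v lv.
case: (eqVneq v r) => [->|vr]; first exact: below_id.
by apply/below_par/IHn; apply: leq_trans (lev_par vr) _.
Qed.

End Tree.

Lemma tree_search (G : sgraph) (r : G) (par : G -> G) (lev : G -> nat) :
  par r = r -> (forall v, v != r -> lev (par v) < lev v) ->
  (forall u v : G, adj u v = (u != v) && ((par u == v) || (par v == u))) ->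
  exists s, mc_search_strategy (trunc_log 2 #|{: G}|).+2 r s.
Proof.
move=> par_root lev_par adj_par; set k := _.+2.
have cl1 : par_closed r par [set r].
  by split=> [|v]; rewrite !inE // => /eqP ->; rewrite par_root.
have edges0 : parent_edges r par [set r] = set0 by rewrite /parent_edges setDv imset0.
have fin : finishable r par k [set r].
  (* The root is not pending, so the successor inside the logarithm gives exactly the number of
     vertices. *)
  have card_R : #|below par r :\: [set r]|.+1 = #|{: G}|.
    by rewrite (below_root lev_par) -cardsT [in RHS](cardsD1 r) inE add1n.
  apply: (finishable_below par_root lev_par adj_par (v := r) cl1) (leqnn _) _ _.
  - by rewrite inE.
  - by move=> w _; rewrite inE => /eqP.
  - rewrite card_R (_ : unfinished _ _ :\ r = set0) ?cards0 //.
    by apply/eqP; rewrite setD_eq0; apply/subsetP => u /setIdP[].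
  - rewrite (below_root lev_par) setUT.
    exact: (finishable_setT par_root lev_par adj_par).
have [|s [cs ms]] := fin (fun=> r).
  have tE := territory_parent_edges (par := par) cl1.
  split=> [|i _]; last by rewrite tE inE.
  apply/subsetP => u; rewrite inE tE => /andP[/set1P -> _].
  by rewrite inE; apply/hasP; exists 0; rewrite ?mem_iota.
exists s, (iota 0 k); split; rewrite ?iota_uniq ?size_iota -?edges0 //.
Qed.

(** * Vertices that have to be guarded *)

Section Visited.
Variables (G : sgraph) (team : seq nat).
Implicit Types (pos : nat -> G) (C : {set {set G}}) (V : {set G}).

(** [V] is to be read as the set of vertices visited so far. *)
Definition within V pos C : Prop :=
  {in team, forall i, pos i \in V} /\ {in C, forall e : {set G}, e \subset V}.

Definition arrivals (s : seq (move G)) : {set G} := [set v in map snd s].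

Lemma arrivals_cons m s : arrivals (m :: s) = m.2 |: arrivals s.
Proof. by apply/setP => v; rewrite !inE. Qed.

Lemma within_move V pos C (m : move G) : m.1 \in team -> within V pos C ->
  within (m.2 |: V) (slide pos m) (clean_after team pos C m).
Proof.
move=> mt [pV CV]; split=> [i it|e /(subsetP (clean_after_sub _ _ _ _))].
  by rewrite /slide; case: ifP => _; rewrite in_setU1 ?eqxx ?pV ?orbT.
rewrite in_setU1 => /predU1P[->|/CV eV]; last by rewrite subsetU // eV orbT.
by rewrite subUset !sub1set setU11 in_setU1 pV ?orbT.
Qed.

Lemma search_covers V pos C s : within V pos C -> connected_search team pos C s ->
  {in edges G, forall e : {set G}, e \subset V :|: arrivals s}.
Proof.
elim: s V pos C => [|m s IHs] V pos C wi /=.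
  by move=> /eqP <- e /wi.2 eV; rewrite subsetU // eV.
case/and4P=> mt _ _ cs e eE; have := IHs _ _ _ (within_move mt wi) cs e eE.
by rewrite arrivals_cons setUCA setUA.
Qed.

(** After at least one move every visited vertex lies on a swept edge, while an edge to an unvisited
    vertex cannot be clean. So [v] is a boundary vertex, and monotonicity forces a guard on it. *)
Lemma search_guards V pos C m s1 s2 : within V pos C ->
  V \subset pos m.1 |: cover C ->
  connected_search team pos C (m :: s1 ++ s2) -> monotone team pos C (m :: s1 ++ s2) ->
  forall v w, v \in V :|: arrivals (m :: s1) -> w \notin V :|: arrivals (m :: s1) ->
    adj v w -> v \in occupied team (foldl (@slide G) pos (m :: s1)).
Proof.
elim: s1 m V pos C => [|m' s1 IHs] m V pos C wi cov.
  rewrite /= => /and4P[mt mE _ _] /andP[mono _] v w.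
  have -> : V :|: arrivals [:: m] = m.2 |: V.
    by apply/setP => x; rewrite !inE orbC.
  move=> vV wV vw; apply: (subsetP (monotone_guarded mono)).
  rewrite [_ \in boundary _]inE; apply/andP; split; apply/exists_inP; last first.
    exists [set v; w]; rewrite ?set21 // in_setD edge_in vw andbT.
    apply: contra wV => /(subsetP mono) /(within_move mt wi).2.
    by rewrite subUset !sub1set => /andP[].
  case/setU1P: vV => [->|/(subsetP cov)/setU1P[->|/bigcupP[e eC ve]]].
  - by exists [set pos m.1; m.2]; rewrite ?setU11 ?set22.
  - by exists [set pos m.1; m.2]; rewrite ?setU11 ?set21.
  - by exists e; rewrite // in_setU1 eC orbT.
move=> cs ms v w; rewrite (arrivals_cons m) setUCA setUA.
move: cs ms => /and4P[mt _ _ cs] /andP[mono ms].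
apply: (IHs _ _ _ _ (within_move mt wi) _ cs ms).
have mem e x : e \in swept pos C m -> x \in e ->
    x \in slide pos m m'.1 |: cover (clean_after team pos C m).
  by move=> /(subsetP mono) eC xe; rewrite in_setU1 (mem_cover eC xe) orbT.
apply/subsetP => x /setU1P[->|/(subsetP cov)/setU1P[->|/bigcupP[e eC]]].
- by apply: (mem [set pos m.1; m.2]); rewrite ?setU11 ?set22.
- by apply: (mem [set pos m.1; m.2]); rewrite ?setU11 ?set21.
- by apply: mem; rewrite in_setU1 eC orbT.
Qed.

End Visited.

Definition visited (G : sgraph) (h : G) (s : seq (move G)) : {set G} :=
  h |: arrivals s.

Section Strategy.
Variables (G : sgraph) (k : nat) (h : G).

Lemma strategy_visits s : mc_search_strategy k h s ->
  forall u v : G, adj u v -> u \in visited h s.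
Proof.
case=> team [_ _ _ cs _] u v; rewrite -edge_in => /(search_covers _ cs (V := [set h])).
rewrite subUset !sub1set => /(_ _)/andP[] //.
by split=> [i _|e]; rewrite inE.
Qed.

Lemma strategy_guards s1 s2 : s1 != [::] -> mc_search_strategy k h (s1 ++ s2) ->
  #|[set v in visited h s1 | [exists w, (w \notin visited h s1) && adj v w]]| <= k.
Proof.
case: s1 => [//|m s1] _ [team [_ <- _ cs ms]].
apply: leq_trans (card_occupied _ (foldl (@slide G) (fun=> h) (m :: s1))).
apply/subset_leq_card/subsetP => v /setIdP[vV /existsP[w /andP[wV vw]]].
apply: (search_guards _ _ cs ms vV wV vw); last by rewrite sub1set setU11.
by split=> [i _|e]; rewrite inE.
Qed.

End Strategy.

(** * Trees on a triangle of the grid *)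

Section Triangle.
Variable L : nat.

Definition triangle_points : seq (int * int) :=
  [seq (Posz p.1, Posz p.2) | p <- [seq p <- allpairs pair (iota 0 L.+1) (iota 0 L.+1)
                              | p.1 + p.2 <= L]].

Definition triangle : {fset int * int} := [fset p in triangle_points]%fset.

Lemma triangleP p :
  reflect (exists x y : nat, x + y <= L /\ p = (Posz x, Posz y)) (p \in triangle).
Proof.
rewrite in_fset; apply: (iffP mapP) => [[[x y]]|[x [y [xy ->]]]].
  by rewrite mem_filter => /andP[xy _] ->; exists x, y.
exists (x, y); rewrite // mem_filter xy; apply/allpairsP; exists (x, y).
by rewrite !mem_iota /=; split=> //; lia.
Qed.

Lemma origin_in : (Posz 0, Posz 0) \in triangle.
Proof. by apply/triangleP; exists 0, 0. Qed.

Definition origin : triangle := [` origin_in]%fset.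

(** Outside the triangle the value is the default [origin], whence the side conditions [x + y <= L]
    below. *)
Definition cell (x y : nat) : triangle := insubd origin (Posz x, Posz y).

Definition abscissa (v : triangle) : nat := `|(val v).1|%N.
Definition ordinate (v : triangle) : nat := `|(val v).2|%N.
Definition level (v : triangle) : nat := abscissa v + ordinate v.

Lemma val_cell x y : x + y <= L -> val (cell x y) = (Posz x, Posz y).
Proof. by move=> xy; rewrite val_insubd ifT //; apply/triangleP; exists x, y. Qed.

Lemma abscissa_cell x y : x + y <= L -> abscissa (cell x y) = x.
Proof. by move=> xy; rewrite /abscissa val_cell. Qed.

Lemma ordinate_cell x y : x + y <= L -> ordinate (cell x y) = y.
Proof. by move=> xy; rewrite /ordinate val_cell. Qed.

Lemma level_cell x y : x + y <= L -> level (cell x y) = x + y.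
Proof. by move=> xy; rewrite /level abscissa_cell ?ordinate_cell. Qed.

Lemma val_node (v : triangle) : val v = (Posz (abscissa v), Posz (ordinate v)).
Proof. by have /triangleP[x [y [_ e]]] := valP v; rewrite /abscissa /ordinate e. Qed.

Lemma level_le (v : triangle) : level v <= L.
Proof.
by have /triangleP[x [y [xy e]]] := valP v; rewrite /level /abscissa /ordinate e.
Qed.

Lemma node_inj (u v : triangle) :
  abscissa u = abscissa v -> ordinate u = ordinate v -> u = v.
Proof. by move=> e1 e2; apply: val_inj; rewrite !val_node e1 e2. Qed.

Lemma cellK (v : triangle) : cell (abscissa v) (ordinate v) = v.
Proof.
by apply: node_inj; rewrite ?abscissa_cell ?ordinate_cell //; apply: level_le.
Qed.

Lemma level_eq0 (v : triangle) : (level v == 0) = (v == origin).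
Proof.
rewrite addn_eq0; apply/andP/eqP => [[/eqP a /eqP o]|->//].
exact: node_inj.
Qed.

Lemma card_triangle : L < #|{: triangle}| <= L.+1 ^ 2.
Proof.
apply/andP; split.
  have inj : injective (fun i : 'I_L.+1 => cell i 0).
    move=> i k /(congr1 abscissa) e; apply: val_inj.
    by rewrite !abscissa_cell ?addn0 -1?ltnS // in e.
  by have := leq_card _ inj; rewrite card_ord.
have inj : injective (fun v : triangle => (inord (abscissa v), inord (ordinate v)) : 'I_L.+1 * 'I_L.+1).
  move=> u v [/(congr1 val) ea /(congr1 val) eo].
  have := level_le u; have := level_le v; rewrite /level => lv lu.
  by apply: node_inj; [move: ea | move: eo]; rewrite /= !inordK //; lia.
by have := leq_card _ inj; rewrite card_prod !card_ord -mulnn.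
Qed.

Variable j : nat -> nat.

(** The abscissa of the branching vertex of diagonal [d]; the minimum keeps it on the diagonal, so
    that every function [j] yields a tree. *)
Definition branch (d : nat) : nat := minn (j d) d.

(** Vertices up to the branching abscissa of the previous diagonal are entered from below, the
    others from the left. At the origin the truncated predecessors give the origin itself. *)
Definition parent (v : triangle) : triangle :=
  if abscissa v <= branch (level v).-1 then cell (abscissa v) (ordinate v).-1
  else cell (abscissa v).-1 (ordinate v).

Lemma parent_root : parent origin = origin.
Proof. by rewrite /parent /= -[RHS]cellK. Qed.

Variant parent_spec (v : triangle) : triangle -> Prop :=
  | ParentUp y of ordinate v = y.+1 & abscissa v <= branch (level v).-1 :
      parent_spec v (cell (abscissa v) y)
  | ParentRight x of abscissa v = x.+1 & branch (level v).-1 <= x :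
      parent_spec v (cell x (ordinate v)).

Lemma parentP v : v != origin -> parent_spec v (parent v).
Proof.
rewrite -level_eq0 /parent => lv; case: leqP => av.
  have /prednK oE : 0 < ordinate v.
    by move: av lv; rewrite /branch /level leq_min; lia.
  by constructor; rewrite // oE.
have /prednK aE : 0 < abscissa v by apply: leq_trans av.
by constructor; rewrite ?aE // -ltnS aE.
Qed.

Lemma level_parent v : v != origin -> level v = (level (parent v)).+1.
Proof.
move=> vo; have := level_le v.
case: (parentP vo) => [y e _|x e _]; rewrite /level /= => le;
  by rewrite ?abscissa_cell ?ordinate_cell; lia.
Qed.

Lemma level_parent_lt v : v != origin -> level (parent v) < level v.
Proof. by move=> /level_parent ->. Qed.

Definition tree_adj : rel triangle :=
  fun u v => (u != v) && ((parent u == v) || (parent v == u)).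

Lemma tree_adj_sym : symmetric tree_adj.
Proof. by move=> u v; rewrite /tree_adj eq_sym orbC. Qed.

Lemma sqdist_parent v : v != origin -> sqdist (val v) (val (parent v)) = 1%R.
Proof.
move=> vo; have := level_le v; rewrite (val_node v) /level.
case: (parentP vo) => [y e _|x e _] le;
  by rewrite val_cell ?/sqdist /=; lia.
Qed.

Lemma sqdistC p q : sqdist p q = sqdist q p.
Proof. by rewrite /sqdist -sqrrN opprB -[((p.2 - q.2) ^+ 2)%R]sqrrN opprB. Qed.

Lemma tree_adj_dist (u v : triangle) : tree_adj u v -> sqdist (val u) (val v) = 1%R.
Proof.
rewrite /tree_adj => /andP[uv /orP[]/eqP e].
  rewrite -e; apply: sqdist_parent; apply: contraNneq uv => u0.
  by rewrite -e u0 parent_root.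
rewrite -e sqdistC; apply: sqdist_parent; apply: contraNneq uv => v0.
by rewrite -e v0 parent_root.
Qed.

Definition tree_grid : partial_grid := PartialGrid tree_adj_sym tree_adj_dist.

Lemma tree_grid_connected : connected_graph tree_grid.
Proof. exact: (@tree_connected tree_grid origin parent level parent_root level_parent_lt). Qed.

Lemma tree_grid_search :
  exists s, @mc_search_strategy tree_grid (trunc_log 2 #|{: triangle}|).+2 origin s.
Proof.
exact: (@tree_search tree_grid origin parent level parent_root level_parent_lt).
Qed.

Definition child_up (v : triangle) : triangle := cell (abscissa v) (ordinate v).+1.
Definition child_right (v : triangle) : triangle := cell (abscissa v).+1 (ordinate v).
(** The one child that every vertex of level below [L] has. The only other children are the right
    children of branching vertices. *)
Definition main_child v :=
  if abscissa v <= branch (level v) then child_up v else child_right v.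
Definition branching (d : 'I_L) : triangle := cell (branch d) (d - branch d).

Lemma branching_coord d :
  [/\ abscissa (branching d) = branch d, ordinate (branching d) = d - branch d
    & level (branching d) = d].
Proof.
have := ltn_ord d; have bd : branch d <= d := geq_minr _ _.
have bK : branch d + (d - branch d) = d by rewrite subnKC.
by move=> /ltnW dL; rewrite abscissa_cell ?ordinate_cell ?level_cell ?bK.
Qed.

Lemma branching_inj : injective branching.
Proof.
move=> d e /(congr1 level); have [_ _ ->] := branching_coord d.
by have [_ _ ->] := branching_coord e; apply: val_inj.
Qed.

Lemma level_main_child v : level v < L -> level (main_child v) = (level v).+1.
Proof.
rewrite /main_child {1}/level => lv.
by case: leqP => _; rewrite level_cell ?addnS ?addSn.
Qed.

Lemma level_child_right v : level v < L -> level (child_right v) = (level v).+1.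
Proof. by rewrite {1}/level => lv; rewrite level_cell ?addSn. Qed.

Lemma parent_main_child v : level v < L -> parent (main_child v) = v.
Proof.
move=> lv; rewrite /parent level_main_child //= /main_child /child_up /child_right.
have lv' : abscissa v + ordinate v < L by [].
case: (leqP (abscissa v) (branch (level v))) => av; rewrite abscissa_cell ?ordinate_cell ?addnS ?addSn //=.
  by rewrite av cellK.
by rewrite leqNgt ltnS ltnW //= cellK.
Qed.

Lemma parent_child_right d : parent (child_right (branching d)) = branching d.
Proof.
have [ab _ lb] := branching_coord d; have := ltn_ord d; rewrite -{1}lb.
move: (branching d) ab lb => v ab lb lv.
have lv' : abscissa v + ordinate v < L by [].
rewrite /parent level_child_right //= /child_right abscissa_cell ?ordinate_cell ?addSn //.
by rewrite lb ab ltnn -ab /= cellK.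
Qed.

Lemma main_child_branching d : main_child (branching d) = child_up (branching d).
Proof. by have [ab ob lb] := branching_coord d; rewrite /main_child ab lb leqnn. Qed.

Lemma childP v : v != origin ->
  v = main_child (parent v) \/ v = child_right (parent v).
Proof.
move=> vo; have lv := level_parent vo; have := level_le v; move: lv.
case: (parentP vo) => [y e av|x e _] lv le; [left | right];
  have cl : abscissa v + ordinate v <= L by [].
  have clp : abscissa v + y <= L by move: cl; rewrite e; lia.
  by move: av; rewrite lv /main_child /= abscissa_cell // => ->;
     rewrite /child_up abscissa_cell // ordinate_cell // -e cellK.
have clp : x + ordinate v <= L by move: cl; rewrite e; lia.
by rewrite /child_right abscissa_cell // ordinate_cell // -e cellK.
Qed.

(* When the branching vertices of all lower diagonals have been visited but
   only one vertex of the last diagonal has, exactly L unvisited vertices have a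
   visited parent; a parent has at most two children. *)
Lemma visited_frontier (V : {set triangle}) z :
  origin \in V -> level z = L -> {in V, forall v, v != z -> level v < L} ->
  (forall d, branching d \in V) ->
  L <= 2 * #|[set v in V | [exists w, (w \notin V) && tree_adj v w]]|.
Proof.
move=> oV lz low brV; set F := [set v in V | _].
(* [B] collects the vertices with a visited parent. It contains the disjoint sets [A], of at least
   [#|V| - 1] main children, and [D], of [L] extra children. *)
pose A := main_child @: (V :\ z); pose D := [set child_right (branching d) | d : 'I_L].
pose B := [set w | (w != origin) && (parent w \in V)].
have low' v : v \in V :\ z -> level v < L by case/setD1P => vz vV; apply: low.
have nonroot w : 0 < level w -> w != origin by rewrite -level_eq0 lt0n.
have cardA : #|V| <= #|A|.+1.
  rewrite card_in_imset; first by rewrite (cardsD1 z V); case: (z \in V).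
  move=> u v uV vV e; rewrite -(parent_main_child (low' _ uV)) e.
  exact: parent_main_child (low' _ vV).
have cardD : #|D| = L.
  rewrite card_imset ?card_ord // => d e /(congr1 parent).
  by rewrite !parent_child_right => /branching_inj.
have disj : A :&: D = set0.
  apply/setP => w; rewrite in_set0; apply/negP => /setIP[/imsetP[v vV ->] /imsetP[d _ e]].
  have vd : v = branching d.
    by rewrite -(parent_main_child (low' _ vV)) e parent_child_right.
  have [ab ob lb] := branching_coord d.
  have lt : abscissa (branching d) + ordinate (branching d) < L.
    by have := low' _ vV; rewrite vd.
  move: e; rewrite vd main_child_branching; move: (branching d) lt => u lt.
  rewrite /child_up /child_right => /(congr1 abscissa).
  by rewrite !abscissa_cell ?addnS ?addSn // => /eqP; rewrite ltn_eqF.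
have sub_B : A :|: D \subset B.
  rewrite subUset; apply/andP; split; apply/subsetP => w /imsetP[v vV ->].
    have lv := low' _ vV.
    rewrite inE parent_main_child // nonroot ?level_main_child //.
    by case/setD1P: vV.
  have [ab ob lb] := branching_coord v.
  by rewrite inE parent_child_right brV andbT nonroot // level_child_right ?lb.
have cardB : #|V| + L <= #|B|.+1.
  apply: leq_trans (_ : #|A :|: D|.+1 <= _); last by rewrite ltnS subset_leq_card.
  by rewrite cardsU disj cards0 subn0 cardD -addSn leq_add2r.
(* The inequality is strict because the origin is visited but not in [B]. Hence at least [L] members
   of [B] are unvisited. *)
have BV : #|B :&: V| < #|V|.
  rewrite [ltnRHS](cardsD1 origin) oV add1n ltnS; apply/subset_leq_card/subsetP => w.
  by rewrite !inE => /andP[/andP[-> _] ->].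
have new : B :\: V \subset main_child @: F :|: child_right @: F.
  apply/subsetP => w; rewrite in_setD [w \in B]inE => /and3P[wV wo pV].
  have pF : parent w \in F.
    rewrite inE pV; apply/existsP; exists w; rewrite wV /tree_adj eqxx orbT andbT.
    by apply: contraNneq wV => <-.
  by rewrite in_setU; case: (childP wo) => ->; rewrite imset_f ?orbT.
have : #|B :\: V| <= 2 * #|F|.
  rewrite mul2n -addnn; apply: leq_trans (subset_leq_card new) _.
  apply: leq_trans (leq_card_setU _ _) _.
  by apply: leq_add; apply: leq_imset_card.
move: cardB BV; rewrite -(cardsID V B).
by move: #|B :&: V| #|B :\: V| #|V| #|F| => a b c d; lia.
Qed.

End Triangle.

(** * The adversary *)

Lemma least_spec (P : nat -> Prop) : (exists k, P k) ->
  P (least P) /\ forall k, P k -> least P <= k.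
Proof.
move=> [k Pk]; have ex : exists k, `[<P k>] by exists k; apply/asboolP.
apply: (@classical_sets.xgetPex _ 0 (fun k => P k /\ forall i, P i -> k <= i)).
case: (ex_minnP ex) => i /asboolP Pi imin; exists i; split=> // l Pl.
by apply: imin; apply/asboolP.
Qed.

Section Adversary.
Variable L : nat.
Local Notation grid j := (tree_grid L j).
Local Notation diagonal m := (level (m : nat * triangle L).2).

Lemma parent_agree (j j' : nat -> nat) d (v : triangle L) :
  {in gtn d, j =1 j'} -> (level v).-1 < d -> parent j v = parent j' v.
Proof. by move=> jj' lv; rewrite /parent /branch jj'. Qed.

Lemma tree_adj_level (j : nat -> nat) (u v : triangle L) :
  tree_adj j u v -> level v <= (level u).+1.
Proof.
rewrite /tree_adj => /andP[uv /orP[]/eqP e].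
  have uo : u != origin L by apply: contraNneq uv => u0; rewrite -e u0 parent_root.
  by rewrite (level_parent j uo) e leqW // leqW.
have vo : v != origin L by apply: contraNneq uv => v0; rewrite -e v0 parent_root.
by rewrite (level_parent j vo) e.
Qed.

Lemma tree_adj_agree (j j' : nat -> nat) d (u v : triangle L) :
  {in gtn d, j =1 j'} -> level u < d -> tree_adj j u v = tree_adj j' u v.
Proof.
move=> jj' ud; have [vd|dv] := leqP (level v) d.
  case: (posnP d) => [d0|d_gt0]; first by rewrite d0 in ud.
  by rewrite /tree_adj !(parent_agree jj') //; lia.
transitivity false; [|symmetry]; apply/negP => /tree_adj_level; lia.
Qed.

Lemma leads_agree (j j' : nat -> nat) d (dir : direction) (u v : triangle L) :
  {in gtn d, j =1 j'} -> level u < d ->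
  @leads (grid j) dir u v = @leads (grid j') dir u v.
Proof.
by move=> jj' ud; rewrite /leads; congr (_ && _); apply: tree_adj_agree jj' ud.
Qed.

(** The edges at [u] go to its parent and its children, and are fixed by the branching on diagonals
    up to that of [u]. *)
Lemma ports_agree (j j' : nat -> nat) d (u : triangle L) :
  {in gtn d, j =1 j'} -> level u < d -> @ports (grid j) u = @ports (grid j') u.
Proof.
move=> jj' ud; apply/setP => dir; rewrite !inE; apply: eq_existsb => v.
exact: leads_agree jj' ud.
Qed.

(** All the trees share the points of the triangle, so the same port leads to the same point even in
    different networks. *)
Lemma leads_inj (j j' : nat -> nat) (dir : direction) (u v v' : triangle L) :
  @leads (grid j) dir u v -> @leads (grid j') dir u v' -> v' = v.
Proof. by move=> /andP[_ /eqP e] /andP[_ /eqP e']; apply: val_inj; rewrite e e'. Qed.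

(* Up to the first arrival on diagonal d, nothing that the searchers learn
   depends on how the diagonals from d on branch. *)
Lemma runs_agree A (j j' : nat -> nat) d (h : triangle L) s0 m s2 s' pos l :
  {in gtn d, j =1 j'} -> level h < d -> (forall i, level (pos i) < d) ->
  all (fun m => diagonal m < d) s0 ->
  @runs_from A (grid j) h pos l (s0 ++ m :: s2) ->
  @runs_from A (grid j') h pos l s' ->
  exists s2', s' = s0 ++ m :: s2'.
Proof.
move=> jj' hd; elim: s0 s' pos l => [|m0 s0 IHs] [|m' s'] pos l posd.
- move=> _ /=; rewrite -(ports_agree jj' hd).
  by case: (A _ _) => [[i dir]|//].
- move=> _ /=; rewrite -(ports_agree jj' hd).
  case: (A _ _) => [[i dir]|//] /and3P[/eqP m1 mv _] /and3P[/eqP m1' mv' _].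
  exists s'; congr (_ :: _); case: m m' m1 m1' mv mv' => [i1 v] [i2 v'] /= -> -> mv mv'.
  by congr pair; apply: (leads_inj mv mv').
- move=> _ /=; rewrite -(ports_agree jj' hd).
  by case: (A _ _) => [[i dir]|//].
rewrite /= => /andP[m0d s0d]; rewrite -(ports_agree jj' hd).
case: (A _ _) => [[i dir]|//] /and3P[/eqP m1 mv rs] /and3P[/eqP m1' mv' rs'].
have e : m' = m0.
  case: m0 m' m1 m1' mv mv' {m0d rs rs'} => [i1 v] [i2 v'] /= -> -> mv mv'.
  by congr pair; apply: (leads_inj mv mv').
move: rs'; rewrite e -(ports_agree jj' m0d) => rs'.
have [|s2' ->] := IHs _ _ _ _ s0d rs rs'; last by exists s2'.
by move=> i0; rewrite /slide; case: ifP.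
Qed.

(** An edge climbs by at most one diagonal, so no diagonal can be skipped. *)
Lemma first_arrival A j d (h : triangle L) s0 m s2 pos l :
  (forall i, level (pos i) < d) -> all (fun m => diagonal m < d) s0 ->
  @runs_from A (grid j) h pos l (s0 ++ m :: s2) -> diagonal m <= d.
Proof.
elim: s0 pos l => [|m0 s0 IHs] pos l posd /=.
  case: (A _ _) => [[i dir]|//] _ /and3P[/eqP _ /andP[/tree_adj_level mi _] _].
  exact: leq_trans mi _.
move=> /andP[m0d s0d]; case: (A _ _) => [[i dir]|//] /and3P[_ _ rs].
by apply: IHs s0d rs => i0; rewrite /slide; case: ifP.
Qed.

(** A complete search visits every non-isolated vertex, in particular one on diagonal [d.+1]; the
    first move beyond diagonal [d] lands exactly there. *)
Lemma next_diagonal A j d k s1 s2 : d < L ->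
  @execution A (grid j) (origin L) (s1 ++ s2) ->
  @mc_search_strategy (grid j) k (origin L) (s1 ++ s2) ->
  all (fun m => diagonal m <= d) s1 ->
  exists t0 m t2, [/\ s2 = t0 ++ m :: t2, all (fun m => diagonal m <= d) (s1 ++ t0)
                   & diagonal m = d.+1].
Proof.
move=> dL ex strat s1d; pose v := cell L d.+1 0.
have lv : level v = d.+1 by rewrite level_cell addn0.
have vo : v != origin L by rewrite -level_eq0 lv.
have adjv : @adj (grid j) v (parent j v).
  by rewrite adj_sym; apply: (@adj_parent (grid j) (origin L) (parent j) (@level L) (@level_parent_lt L j)).
have := strategy_visits strat adjv; rewrite in_setU1 (negPf vo) inE => /mapP[m ms ev].
have hs : has (fun m => d < diagonal m) s2.
  apply/hasP; exists m; last by rewrite -ev lv.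
  by move: ms; rewrite mem_cat => /orP[/(allP s1d)|//]; rewrite -ev lv ltnn.
move: ex; case: (split_find hs) => n t0 t2 nd t0d; rewrite cat_rcons => ex.
have all0 : all (fun m => diagonal m <= d) (s1 ++ t0).
  rewrite all_cat s1d; apply/allP => x xt; rewrite leqNgt.
  by apply: contra t0d => xd; apply/hasP; exists x.
exists t0, n, t2; split=> //; apply/eqP; rewrite eqn_leq nd andbT.
rewrite /execution catA in ex.
by apply: (first_arrival _ _ ex) => //.
Qed.

Definition visits_branchings j d (s : seq (move (grid j))) : Prop :=
  forall e, e < d -> cell L (branch j e) (e - branch j e) \in origin L :: map snd s.

(** By induction on [d]: when a new diagonal is first reached, its branching vertex is redefined to
    be the vertex reached, which the searchers cannot notice earlier. *)
Lemma adversary A d : computes_mc_search A -> d < L ->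
  exists j s0 m s2, [/\ @execution A (grid j) (origin L) (s0 ++ m :: s2),
    all (fun m => diagonal m <= d) s0, diagonal m = d.+1
    & @visits_branchings j d.+1 s0].
Proof.
move=> compA; have run j := compA (grid j) (origin L) (@tree_grid_connected L j).
elim: d => [|d IHd] dL.
  have [s [k [ex strat]]] := run (fun=> 0).
  have [t0 [m [t2 [e t0d md]]]] := next_diagonal (s1 := [::]) dL ex strat isT.
  exists (fun=> 0), t0, m, t2; split=> //; first by rewrite -e.
  (* The origin is the only vertex of diagonal 0, so it is the branching one. *)
  by move=> i; rewrite ltnS leqn0 => /eqP ->; rewrite (cellK (origin L)) mem_head.
have [j [s0 [m [s2 [ex s0d md br]]]]] := IHd (ltnW dL).
pose j' e := if e == d.+1 then abscissa m.2 else j e.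
have jj' : {in gtn d.+1, j =1 j'}.
  by move=> e; rewrite inE /j' => ed; rewrite ltn_eqF.
have [s' [k [ex' strat]]] := run j'.
(* The arrival [m] itself survives the change of tree, since it leaves from a vertex below diagonal
   [d.+1]. *)
have [s2' e'] : exists s2', s' = s0 ++ m :: s2' by apply: runs_agree jj' _ _ s0d ex ex'.
move: ex' strat; rewrite e' -cat_rcons => ex' strat.
have s1d : all (fun m => diagonal m <= d.+1) (rcons s0 m).
  by rewrite all_rcons md leqnn; apply: sub_all s0d => x; apply: leqW.
have [t0 [n [t2 [e t0d nd]]]] := next_diagonal dL ex' strat s1d.
exists j', (rcons s0 m ++ t0), n, t2; split=> //; first by rewrite -catA -e.
move=> i; rewrite ltnS leq_eqVlt => /predU1P[->|id].
  have -> : branch j' d.+1 = abscissa m.2.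
    (* The vertex reached lies on diagonal [d.+1], so its abscissa is not truncated. *)
    by rewrite /branch /j' eqxx; apply/minn_idPl; rewrite -md leq_addr.
  rewrite -[X in X - _]md /level addKn cellK in_cons map_cat map_rcons mem_cat.
  by rewrite mem_rcons mem_head orbT.
have -> : branch j' i = branch j i by rewrite /branch jj'.
have := br i id; rewrite !in_cons map_cat map_rcons mem_cat mem_rcons in_cons.
by case/orP=> ->; rewrite ?orbT.
Qed.

End Adversary.

Lemma adversary_lower_bound L A : 0 < L -> computes_mc_search A ->
  exists j : nat -> nat,
    L <= 2 * searchers_used A (tree_grid L j) (origin L).
Proof.
case: L => // L _ compA.
have [j [s0 [m [s2 [ex s0d md br]]]]] := adversary compA (ltnSn L).
exists j; set P := fun k => exists s, execution A (origin L.+1 : tree_grid L.+1 j) s /\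
  mc_search_strategy k (origin L.+1 : tree_grid L.+1 j) s.
have [k [s [ex' strat]] ] : exists k, P k.
  have [s [k ?]] := compA _ (origin L.+1 : tree_grid L.+1 j) (@tree_grid_connected _ j).
  by exists k, s.
(* As [P] holds somewhere, [searchers_used] is attained by an actual run instead of being the
   default 0. *)
have [[s' [{}ex' {}strat]] _] := least_spec (ex_intro P k (ex_intro _ s (conj ex' strat))).
(* Determinism of the execution: the case [j = j'] of [runs_agree]. *)
have [t2 e] : exists t2, s' = s0 ++ m :: t2.
  by apply: (@runs_agree _ A j j L.+1) s0d ex ex'.
rewrite e -cat_rcons in strat; set u := searchers_used _ _ _.
have nil : rcons s0 m != [::] by case: (s0).
apply: leq_trans (_ : _ <= 2 * _) _; last first.
  by rewrite leq_mul2l; apply: (strategy_guards nil strat).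
apply: (visited_frontier (z := m.2)) => //.
- by rewrite setU11.
- move=> v; rewrite in_setU1 => /predU1P[-> _|]; first by [].
  rewrite inE map_rcons mem_rcons in_cons => /predU1P[->|/mapP[x xs ->] _].
    by rewrite eqxx.
  by rewrite ltnS (allP s0d).
- move=> d; have := br d (ltn_ord d); rewrite in_cons => /predU1P[dE|ds].
    by rewrite /branching dE setU11.
  by rewrite in_setU1 inE map_rcons mem_rcons in_cons ds !orbT.
Qed.

(** * The ratio in terms of the number of vertices *)

Local Open Scope ring_scope.

Lemma mcs_tree_grid L j :
  (0 < mcs (tree_grid L j) <= (trunc_log 2 #|{: triangle L}|).+2)%N.
Proof.
have [s strat] := tree_grid_search L j.
have [[h [s' [team [_ _ m_gt0 _ _]]]] min] :
  _ /\ forall k, _ -> (mcs (tree_grid L j) <= k)%N :=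
  least_spec (ex_intro (fun k => exists (h : tree_grid L j) (s : seq (move (tree_grid L j))),
    mc_search_strategy k h s) _ (ex_intro _ _ (ex_intro _ s strat))).
by rewrite m_gt0; apply: min; exists (origin L : tree_grid L j), s.
Qed.

(** The 12 is 4 times 3: [sqrt n <= L + 1 <= 2 L <= 4 u], and
    [m ln 2 <= (log2 n + 2) ln 2 <= 3 ln n] because [n >= 2]. *)
Lemma ratio_bound (R : realType) (L n u m : nat) :
  (0 < L < n)%N -> (n <= L.+1 ^ 2)%N -> (L <= 2 * u)%N ->
  (0 < m <= (trunc_log 2 n).+2)%N ->
  ln 2 / 12 * (Num.sqrt n%:R / ln n%:R) <= u%:R / m%:R :> R.
Proof.
move=> /andP[L0 Ln] nL Lu /andP[m0 mt].
have n2 : (1 < n)%N by lia.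
have ln2 : 0 < ln 2 :> R by rewrite ln_gt0 // ltr1n.
have lnn : ln 2 <= ln n%:R :> R.
  by rewrite ler_ln ?posrE ?ltr0n ?ler_nat //; lia.
have lnt : (trunc_log 2 n)%:R * ln 2 <= ln n%:R :> R.
  rewrite mulr_natl -lnXn // ler_ln ?posrE ?exprn_gt0 ?ltr0n //; last by lia.
  by rewrite -natrX ler_nat trunc_logP //; lia.
have mln : m%:R * ln 2 <= 3 * ln n%:R :> R.
  have : m%:R <= (trunc_log 2 n)%:R + 2 :> R by rewrite -natrD ler_nat addn2.
  by move=> /(ler_wpM2r (ltW ln2)); lra.
have sqrtn : Num.sqrt n%:R <= 4 * u%:R :> R.
  rewrite -[leRHS]ger0_norm ?mulr_ge0 // -sqrtr_sqr ler_sqrt ?exprn_ge0 ?mulr_ge0 //.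
  rewrite -natrM -natrX ler_nat (leq_trans nL) // leq_exp2r //; lia.
have lnn0 : 0 < ln n%:R :> R by apply: lt_le_trans lnn.
rewrite ler_pdivlMr ?ltr0n // mulrA mulrAC ler_pdivrMr //.
have s0 := sqrtr_ge0 (n%:R : R).
apply: (@le_trans _ _ (Num.sqrt n%:R / 12 * (m%:R * ln 2))); first by lra.
apply: (@le_trans _ _ (Num.sqrt n%:R / 12 * (3 * ln n%:R))).
  by rewrite ler_wpM2l // divr_ge0.
have := ler_wpM2r (ltW lnn0) sqrtn; lra.
Qed.

Theorem theorem1 (R : realType) :
  exists c : R, 0 < c /\
    forall A : algorithm, computes_mc_search A ->
    forall N : nat, exists n : nat, (N <= n)%N /\
    exists (G : partial_grid) (h : G),
      [/\ connected_graph G, #|{: G}| = n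
        & c * (Num.sqrt n%:R / ln n%:R)
            <= (searchers_used A G h)%:R / (mcs G)%:R].
Proof.
exists (ln 2 / 12); split; first by rewrite divr_gt0 // ln_gt0 // ltr1n.
move=> A compA N; exists #|{: triangle N.+1}|.
have /andP[nlow nhigh] := card_triangle N.+1; split; first by rewrite ltnW // ltnW.
have [j low] := adversary_lower_bound (ltn0Sn N) compA.
exists (tree_grid N.+1 j), (origin N.+1); split=> //.
  exact: tree_grid_connected.
exact: (@ratio_bound R N.+1 _ _ _ nlow nhigh low (mcs_tree_grid _ _)).
Qed.
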